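(* Let $G=G_1 \square G_2 \square \cdots \square G_k$ with $k\geq 2$ be a connected graph decomposed into its Cartesian prime factors, and let $f$ be a (total) coloring of $G$. If for each $i=1,\ldots,k$ the reduced-factor coloring $G_i^f$ is a distinguishing (total) coloring of $G_i$, and $G_i^f \not\simeq G_j^f$ for all $j\neq i$, then $f$ is a distinguishing coloring of $G$.
   Context: The Cartesian product $G\square H$ has vertex set $V(G)\times V(H)$, with $(g,h)$, $(g',h')$ adjacent iff either $g=g'$ and $hh'\in E(H)$, or $gg'\in E(G)$ and $h=h'$. A graph is prime if it is not a Cartesian product of two non-trivial graphs; every connected graph has a unique prime factorization. A total coloring assigns a color to every vertex and every edge (no properness is required); vertex colorings and edge colorings are regarded as total colorings by giving all edges, respectively all vertices, one fixed color. A (vertex, edge or total) coloring is distinguishing if no automorphism other than the identity preserves it. Let $G=G_1\square\cdots\square G_k$ be the prime factorization, let $f$ be a total coloring of $G$, and write $Q_i = G_1\square\cdots\square G_{i-1}\square G_{i+1}\square\cdots\square G_k$, so $G\simeq G_i\square Q_i$. Fix an ordering of the vertices of each factor, $V(G_i)=\{1_i,2_i,\ldots,m_i\}$, where $1_r$ denotes the first vertex of $G_r$. For each vertex $j_i$ of $G_i$ put $u_j=(1_1,\ldots,1_{i-1},j_i,1_{i+1},\ldots,1_k)$ and let $Q_i^{u_j}$ be the $Q_i$-layer through $u_j$, i.e. the subgraph of $G$ induced by all vertices whose $i$-th coordinate is $j_i$ (it is isomorphic to $Q_i$). Vertex colors: let $\check{Q}_i^{u_j}=(Q_i^{u_j},f)$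 be the graph $Q_i^{u_j}$ with the total coloring obtained by restricting $f$. Two such colors $\check{Q}_i^{u_j}$ and $\check{Q}_i^{u_t}$ are equivalent if there is an isomorphism $Q_i^{u_j}\to Q_i^{u_t}$ preserving the total coloring. Edge colors: for an edge $e=u_iv_i$ of $G_i$, let $\overline{Q_i^e}$ be the graph isomorphic to $Q_i$ whose vertices are the edges of $G$ of the form $(u_i,x)(v_i,x)$, $x\in V(Q_i)$ (the edges of $G$ joining the vertices with $i$-th coordinate $u_i$ resp. $v_i$ and all other coordinates given by $x$), where $(u_i,x)(v_i,x)$ and $(u_i,y)(v_i,y)$ are adjacent iff $xy\in E(Q_i)$. Let $\hat{\overline{Q_i^e}}=(\overline{Q_i^e},f)$ be this graph with the vertex coloring in which $(u_i,x)(v_i,x)$ receives the color $f((u_i,x)(v_i,x))$. Two such colors $\hat{\overline{Q_i^e}}$ and $\hat{\overline{Q_i^{e'}}}$ are equivalent if there is a vertex-color-preserving isomorphism $\overline{Q_i^e}\to\overline{Q_i^{e'}}$. The reduced-factor coloring $G_i^f$ of $G_i$ induced by $f$ is the total coloring of $G_i$ in which the vertex $j_i$ (identified with $u_j$) is colored by $\check{Q}_i^{u_j}$ and each edge $e$ of $G_i$ is colored by $\hat{\overline{Q_i^e}}$; equivalent colors are regarded as the same color. The same notion of equivalence (existence of a color-preserving isomorphism) is used to compare colors coming from different factors. One writes $G_i^f\simeq G_j^f$ if there is an isomorphism $G_i\to G_j$ preserving these total colorings. *)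

(* Defs.v *)
From mathcomp Require Import all_boot.

Set Implicit Arguments.
Unset Strict Implicit.
Unset Printing Implicit Defensive.

Record sgraph := SGraph {
  svertex :> finType;
  sadj : rel svertex;
  sadj_sym : symmetric sadj;
  sadj_irr : irreflexive sadj }.

Definition connected_graph (G : sgraph) : Prop :=
  forall x y : G, connect (@sadj G) x y.

Definition is_iso (G H : sgraph) (phi : G -> H) : Prop :=
  bijective phi /\ forall x y : G, sadj (phi x) (phi y) = sadj x y.

Section Induced.
Variables (G : sgraph) (S : {set G}).

Definition induced_adj : rel {x : G | x \in S} :=
  fun x y => sadj (val x) (val y).

Lemma induced_adj_sym : symmetric induced_adj.
Proof. by move=> x y; apply: sadj_sym. Qed.

Lemma induced_adj_irr : irreflexive induced_adj.
Proof. by move=> x; apply: sadj_irr. Qed.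

Definition induced : sgraph := SGraph induced_adj_sym induced_adj_irr.
End Induced.

Section BinaryProduct.
Variables G H : sgraph.

Definition box_adj : rel (G * H)%type := fun x y =>
  ((x.1 == y.1) && sadj x.2 y.2) || (sadj x.1 y.1 && (x.2 == y.2)).

Lemma box_adj_sym : symmetric box_adj.
Proof.
by move=> x y; rewrite /box_adj (eq_sym x.1) (eq_sym x.2) !(sadj_sym x.1 y.1)
  !(sadj_sym x.2 y.2).
Qed.

Lemma box_adj_irr : irreflexive box_adj.
Proof. by move=> x; rewrite /box_adj !sadj_irr andbF. Qed.

Definition box : sgraph := SGraph box_adj_sym box_adj_irr.
End BinaryProduct.

(* The product of a family, i.e. the iterated binary product up to the
   associativity and commutativity isomorphisms. *)
Section FamilyProduct.
Variables (I : finType) (G : I -> sgraph).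

Definition bigbox_adj : rel {dffun forall i, G i} := fun x y =>
  [exists i, sadj (x i) (y i) && [forall j, (j != i) ==> (x j == y j)]].

Lemma bigbox_adj_sym : symmetric bigbox_adj.
Proof.
move=> x y; apply: eq_existsb => i; rewrite sadj_sym; congr andb.
by apply: eq_forallb => j; rewrite (eq_sym (x j)).
Qed.

Lemma bigbox_adj_irr : irreflexive bigbox_adj.
Proof. by move=> x; apply/existsP => -[i]; rewrite sadj_irr. Qed.

Definition bigbox : sgraph := SGraph bigbox_adj_sym bigbox_adj_irr.
End FamilyProduct.

(* K_1 is excluded: otherwise prime factorizations would not be unique. *)
Definition prime_graph (G : sgraph) : Prop :=
  1 < #|G| /\
  forall A B : sgraph, 1 < #|A| -> 1 < #|B| ->
    ~ exists phi : G -> box A B, is_iso phi.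

(* [ecol] is only ever read at edges [set x; y] with sadj x y; its values at
   other sets are irrelevant.  Vertex colorings are the case EC = unit. *)
Record coloring (VC EC : Type) (G : sgraph) := Coloring {
  vcol : G -> VC;
  ecol : {set G} -> EC }.

Definition preserves (VC EC : Type) (G H : sgraph)
    (f : coloring VC EC G) (g : coloring VC EC H) (phi : G -> H) : Prop :=
  (forall x : G, vcol g (phi x) = vcol f x) /\
  (forall x y : G, sadj x y ->
     ecol g [set phi x; phi y] = ecol f [set x; y]).

Definition distinguishing (VC EC : Type) (G : sgraph)
    (f : coloring VC EC G) : Prop :=
  forall phi : G -> G, is_iso phi -> preserves f f phi -> phi =1 id.

Definition restrict (VC EC : Type) (G : sgraph) (f : coloring VC EC G)
    (S : {set G}) : coloring VC EC (induced S) :=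
  @Coloring VC EC (induced S)
    (fun x => vcol f (val x))
    (fun e : {set {x : G | x \in S}} => ecol f (val @: e)).

Record cgraph (VC EC : Type) := CGraph {
  cgraph_graph :> sgraph;
  cgraph_col : coloring VC EC cgraph_graph }.

Definition cg_equiv (VC EC : Type) (H K : cgraph VC EC) : Prop :=
  exists phi : H -> K,
    is_iso phi /\ preserves (cgraph_col H) (cgraph_col K) phi.

(* A colored graph used as a color is represented by its equivalence class,
   so that equivalent colors are equal; this relies on propositional and
   functional extensionality. *)
Definition cg_class (VC EC : Type) (H : cgraph VC EC) : cgraph VC EC -> Prop :=
  cg_equiv H.

Section ReducedFactor.
Variables (I : finType) (G : I -> sgraph) (C : Type).
Variables (f : coloring C C (bigbox G)) (i : I).

Definition cofactor_graph : sgraph :=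
  bigbox (fun j : {j : I | j != i} => G (val j)).

Definition coproj (x : bigbox G) : cofactor_graph :=
  finfun (fun j : {j : I | j != i} => x (val j)).

(* The layer depends on u_j only through its i-th coordinate u. *)
Definition layer (u : G i) : {set bigbox G} := [set x : bigbox G | x i == u].

Definition layer_cgraph (u : G i) : cgraph C C := CGraph (restrict f (layer u)).

(* The edges (u,x)(v,x) of the product lying over the edge e = [set u; v] of
   the i-th factor, where a = (u,x) and b = (v,x). *)
Definition edge_fiber (e : {set G i}) : {set {set bigbox G}} :=
  [set E : {set bigbox G} | [exists a : bigbox G, exists b : bigbox G,
     [&& E == [set a; b], sadj a b, coproj a == coproj b
       & e == [set a i; b i]]]].

Definition fiber_adj (e : {set G i}) :
    rel {E : {set bigbox G} | E \in edge_fiber e} :=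
  fun E F => [exists a in val E, exists b in val F,
                sadj (coproj a) (coproj b)].

Lemma fiber_adj_sym e : symmetric (@fiber_adj e).
Proof.
suff imp E F : @fiber_adj e E F -> @fiber_adj e F E.
  by move=> E F; apply/idP/idP; apply: imp.
case/existsP=> a /andP[aE /existsP[b /andP[bF ab]]].
apply/existsP; exists b; rewrite bF; apply/existsP; exists a.
by rewrite aE sadj_sym.
Qed.

Lemma fiber_adj_irr e : irreflexive (@fiber_adj e).
Proof.
move=> [E /= EP]; apply/negbTE/negP => /existsP[a /andP[/= aE]].
case/existsP=> b /andP[/= bE]; move: EP; rewrite inE.
case/existsP=> c /existsP[d /and4P[/eqP defE _ /eqP cd _]].
move: aE bE; rewrite defE !inE.
by case/orP=> /eqP-> /orP[] /eqP->; rewrite ?cd bigbox_adj_irr.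
Qed.

Definition fiber_graph (e : {set G i}) : sgraph :=
  SGraph (@fiber_adj_sym e) (@fiber_adj_irr e).

Definition fiber_cgraph (e : {set G i}) : cgraph C unit :=
  CGraph (@Coloring C unit (fiber_graph e)
            (fun E : {E : {set bigbox G} | E \in edge_fiber e} =>
               ecol f (val E))
            (fun=> tt)).

Definition reduced_coloring :
    coloring (cgraph C C -> Prop) (cgraph C unit -> Prop) (G i) :=
  Coloring (fun u => cg_class (layer_cgraph u))
           (fun e => cg_class (fiber_cgraph e)).

Definition reduced_factor :
    cgraph (cgraph C C -> Prop) (cgraph C unit -> Prop) :=
  CGraph reduced_coloring.
End ReducedFactor.

(* Main.v *)
Require Import Defs.
From mathcomp Require Import all_boot.
From Stdlib Require Import FunctionalExtensionality PropExtensionality.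

Set Implicit Arguments.
Unset Strict Implicit.
Unset Printing Implicit Defensive.

(** Sabidussi-Vizing in the form needed here: an isomorphism phi between
  connected products of primes acts factorwise.  Distances in a product add up
  over the coordinates, so a layer is convex and a convex set is a box, i.e.
  closed under replacing a coordinate of one point by that of another.  The
  image of a layer of a prime factor is thus a box isomorphic to a prime graph,
  which forces it into a single layer of the target.  Each vertex has a gate in
  each layer (its projection), and phi preserves gates, so one coordinate of
  phi x depends on x i alone, through an isomorphism psi of factors.  If phi
  preserves f, it carries layers to layers and edge fibers to edge fibers, so
  psi preserves the reduced colorings; hence psi does not change the factor,
  and it is the identity there. *)

(** * Walk distance and metric betweenness in a connected graph *)

Section Distance.
Variable G : sgraph.

Fixpoint walk n (x y : G) : bool :=
  if n is m.+1 then [exists z, sadj x z && walk m z y] else x == y.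

Lemma walk_trans m n (x y z : G) : walk m x y -> walk n y z -> walk (m + n) x z.
Proof.
elim: m x => [|m IHm] x /= => [/eqP-> //|/existsP[t /andP[xt ty]] yz].
by apply/existsP; exists t; rewrite xt IHm.
Qed.

Lemma connect_walk (x y : G) : connect (@sadj G) x y -> exists n, walk n x y.
Proof.
case/connectP=> p; elim: p x => [|z p IHp] x /= => [_ ->|/andP[xz zp] /IHp].
  by exists 0; apply: eqxx.
by case=> // n zy; exists n.+1; apply/existsP; exists z; rewrite xz.
Qed.

Hypothesis cG : connected_graph G.

Definition gdist (x y : G) : nat := ex_minn (connect_walk (cG x y)).

Lemma walk_gdist x y : walk (gdist x y) x y.
Proof. by rewrite /gdist; case: ex_minnP. Qed.

Lemma gdist_min n x y : walk n x y -> gdist x y <= n.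
Proof. by rewrite /gdist; case: ex_minnP => m _; apply. Qed.

Lemma gdist_eq0 x y : (gdist x y == 0) = (x == y).
Proof.
apply/eqP/idP => [d0|xy]; first by have := walk_gdist x y; rewrite d0.
by apply/eqP; rewrite -leqn0 (@gdist_min 0).
Qed.

Lemma gdistxx x : gdist x x = 0.
Proof. by apply/eqP; rewrite gdist_eq0. Qed.

Lemma gdist_triangle z x y : gdist x y <= gdist x z + gdist z y.
Proof. exact: gdist_min (walk_trans (walk_gdist x z) (walk_gdist z y)). Qed.

Lemma gdist_adj x y z : sadj x z -> gdist x y <= (gdist z y).+1.
Proof.
by move=> xz; apply: gdist_min; apply/existsP; exists z; rewrite xz; apply: walk_gdist.
Qed.

Lemma gdist_step x y : x != y -> exists2 z, sadj x z & gdist x y = (gdist z y).+1.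
Proof.
rewrite -gdist_eq0; case def_n: (gdist x y) => [//|n] _.
have := walk_gdist x y; rewrite def_n => /existsP[z /andP[xz zy]].
exists z => //; congr _.+1; apply/eqP; rewrite eqn_leq gdist_min // andbT.
by rewrite -ltnS -def_n gdist_adj.
Qed.

Definition between (z x y : G) : bool := gdist x z + gdist z y == gdist x y.

(** Adding the two equalities leaves distance 0 between y and z. This gives the uniqueness of
    gates. *)
Lemma between_antisym x y z : between y x z -> between z x y -> y = z.
Proof.
move=> /eqP yxz /eqP zxy; apply/eqP; rewrite -gdist_eq0 -leqn0.
by rewrite -(leq_add2l (gdist x y)) yxz addn0 -zxy leq_addr.
Qed.

End Distance.

(** * Isomorphisms are isometries *)

Lemma is_iso_inv (G H : sgraph) (phi : G -> H) : is_iso phi ->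
  exists psi, [/\ is_iso psi, cancel phi psi & cancel psi phi].
Proof.
case=> -[psi phiK psiK] adj_phi; exists psi; split=> //; split; first by exists phi.
by move=> x y; rewrite -adj_phi !psiK.
Qed.

Section IsoDistance.
Variables (G H : sgraph) (phi : G -> H).
Hypothesis iso_phi : is_iso phi.

Lemma walk_iso n x y : walk n (phi x) (phi y) = walk n x y.
Proof.
have [[psi phiK psiK] adj_phi] := iso_phi.
elim: n x => [|n IHn] x /=; first by rewrite (can_eq phiK).
apply/existsP/existsP => -[z /andP[xz zy]].
  by exists (psi z); rewrite -adj_phi -IHn psiK xz.
by exists (phi z); rewrite adj_phi IHn xz.
Qed.

Lemma gdist_iso (cG : connected_graph G) (cH : connected_graph H) x y :
  gdist cH (phi x) (phi y) = gdist cG x y.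
Proof.
apply/eqP; rewrite eqn_leq !gdist_min //; first by rewrite -walk_iso walk_gdist.
by rewrite walk_iso walk_gdist.
Qed.

Lemma between_iso (cG : connected_graph G) (cH : connected_graph H) z x y :
  between cH (phi z) (phi x) (phi y) = between cG z x y.
Proof. by rewrite /between !(gdist_iso cG). Qed.

End IsoDistance.

(** * Coordinates and adjacency in a product *)

Section Coordinates.
Variables (I : finType) (G : I -> sgraph).
Implicit Types (x y z : bigbox G) (i j : I).

(** The vertices [upd x u] form the i-layer of x, and [upd y (x i)] is the gate of x in the i-layer
    of y. *)
Definition upd x i (u : G i) : bigbox G := finfun (dfwith x u).

Lemma upd_in x i (u : G i) : upd x u i = u.
Proof. by rewrite ffunE dfwith_in. Qed.

Lemma upd_out x i (u : G i) j : j != i -> upd x u j = x j.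
Proof. by move=> ji; rewrite ffunE dfwith_out // eq_sym. Qed.

Lemma coprojE i x (j : {j | j != i}) : coproj i x j = x (val j).
Proof. exact: ffunE. Qed.

Lemma coprojP i x y :
  reflect (forall j, j != i -> x j = y j) (coproj i x == coproj i y).
Proof.
apply: (iffP eqP) => [/ffunP exy j ji|exy].
  by have := exy (exist _ j ji); rewrite !coprojE.
by apply/ffunP => -[j ji]; rewrite !coprojE exy.
Qed.

Lemma coproj_upd x i (u : G i) : coproj i (upd x u) = coproj i x.
Proof. by apply/eqP/coprojP => j /upd_out->. Qed.

Lemma coproj_inj i x y : coproj i x = coproj i y -> x i = y i -> x = y.
Proof.
move=> /eqP/coprojP exy exyi; apply/ffunP => j.
by have [->|/exy] := eqVneq j i.
Qed.

Lemma eq_upd i x y : coproj i x = coproj i y -> x = upd y (x i).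
Proof.
by move=> exy; apply: (@coproj_inj i); rewrite ?coproj_upd ?upd_in.
Qed.

Lemma upd_eq i (u : G i) x y : coproj i x = coproj i y -> upd x u = upd y u.
Proof.
by move=> exy; apply: (@coproj_inj i); rewrite ?coproj_upd ?upd_in.
Qed.

Lemma bigbox_sadjP x y :
  reflect (exists2 i, sadj (x i) (y i) & coproj i x = coproj i y) (sadj x y).
Proof.
apply: (iffP existsP) => [[i /andP[xyi exy]]|[i xyi /eqP/coprojP exy]].
  exists i => //; apply/eqP/coprojP => j ji.
  by have /forallP/(_ j) := exy; rewrite ji => /eqP.
exists i; rewrite xyi; apply/forallP=> j; apply/implyP=> ji.
by apply/eqP/exy.
Qed.

Lemma sadj_coproj i x y : coproj i x = coproj i y -> sadj x y = sadj (x i) (y i).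
Proof.
move=> exy; apply/bigbox_sadjP/idP => [[j xyj exyj]|xyi]; last by exists i.
have [<- //|ji] := eqVneq j i.
by move/eqP/coprojP/(_ j ji): exy xyj => ->; rewrite sadj_irr.
Qed.

(** An edge changes exactly one coordinate, which either is i or is not. *)
Lemma sadj_coproj_eq i x y : sadj x y -> (coproj i x == coproj i y) = (x i != y i).
Proof.
move=> xy; apply/idP/idP => [/eqP exy|nxy].
  by apply/eqP => exyi; move: xy; rewrite (sadj_coproj exy) exyi sadj_irr.
have [j _ exyj] := bigbox_sadjP _ _ xy.
have [<-|ij] := eqVneq j i; first exact/eqP.
by rewrite eq_sym in ij; move/eqP/coprojP/(_ i ij): exyj nxy => ->; rewrite eqxx.
Qed.

(** Once the i-th coordinates are made equal, only the others can differ. Adjacency in the cofactor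
    thus becomes adjacency in the whole product, where isomorphisms apply. *)
Lemma sadj_of_coproj i x y :
  sadj (coproj i x) (coproj i y) = sadj (upd x (y i)) y.
Proof.
apply/existsP/bigbox_sadjP => [[[j ji] /andP[xy exy]]|[j xy /eqP/coprojP exy]].
  exists j; first by move: xy; rewrite !coprojE upd_out.
  apply/eqP/coprojP => l lj; have [->|li] := eqVneq l i; first by rewrite upd_in.
  move/forallP/(_ (exist _ l li))/implyP: exy.
  by rewrite -val_eqE /= !coprojE upd_out // => /(_ lj)/eqP.
have ji : j != i by apply: contraTneq xy => ->; rewrite upd_in sadj_irr.
exists (exist _ j ji); rewrite !coprojE; move: xy; rewrite upd_out // => -> /=.
apply/forallP => -[l li]; apply/implyP; rewrite -val_eqE /= => lj.
by have := exy l lj; rewrite !coprojE upd_out // => ->.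
Qed.

(* [upd z (x j)] and [upd x (z j)] are the two components of x when the j-th
   factor is split off, with z as the base point: compare [box_adj]. *)
Lemma sadj_box j x y z :
  sadj x y =
    (coproj j x == coproj j y) && sadj (upd z (x j)) (upd z (y j))
    || sadj (upd x (z j)) (upd y (z j)) && (x j == y j).
Proof.
have -> : sadj (upd z (x j)) (upd z (y j)) = sadj (x j) (y j).
  by rewrite (@sadj_coproj j) ?coproj_upd // !upd_in.
have [exy|nxy] := eqVneq (coproj j x) (coproj j y).
  rewrite (upd_eq _ exy) [sadj (upd _ _) _]sadj_irr orbF.
  exact: sadj_coproj.
have [exyj|nxyj] := eqVneq (x j) (y j) => /=; last first.
  rewrite andbF; apply/negbTE; apply: contraNN nxy => xy.
  by rewrite sadj_coproj_eq.
rewrite andbT.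
apply/bigbox_sadjP/bigbox_sadjP => -[i xyi /eqP/coprojP exy]; exists i.
- rewrite !upd_out //; first by apply: contraTneq xyi => ->; rewrite exyj sadj_irr.
  by apply: contraTneq xyi => ->; rewrite exyj sadj_irr.
- apply/eqP/coprojP => l li; have [->|lj] := eqVneq l j; first by rewrite !upd_in.
  by rewrite !upd_out // exy.
- have ij: i != j by apply: contraTneq xyi => ->; rewrite !upd_in sadj_irr.
  by move: xyi; rewrite !upd_out.
apply/eqP/coprojP => l li; have [-> //|lj] := eqVneq l j.
by have := exy l li; rewrite !upd_out.
Qed.

(** A path joining two points of the i-layer of x projects to the factor: its edges in direction i
    remain edges and all others collapse to a point. *)
Lemma connected_factor x i : connected_graph (bigbox G) -> connected_graph (G i).
Proof.
move=> cG u v; have /connectP[p] := cG (upd x u) (upd x v).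
move=> xp /(congr1 (fun y : bigbox G => y i)); rewrite upd_in => ->.
rewrite -[u in connect _ u _](upd_in x u).
elim: p (upd x u) xp => //= z p IHp y /andP[yz /IHp]; apply: connect_trans.
have [<- //|nyz] := eqVneq (y i) (z i); apply: connect1.
by rewrite -(@sadj_coproj i) //; apply/eqP; rewrite sadj_coproj_eq.
Qed.

(** * Additivity of distance, gates and convexity of layers *)

Section ProductDistance.
Hypotheses (cG : connected_graph (bigbox G)) (cGi : forall i, connected_graph (G i)).

(** Upper bound: while the sum is positive, some coordinate can be moved one step closer by an edge
    of the product. Lower bound: each edge of a walk changes one coordinate, so it lowers the sum by
    at most one. *)
Lemma gdist_bigbox x y : gdist cG x y = \sum_i gdist (@cGi i) (x i) (y i).
Proof.
apply/eqP; rewrite eqn_leq; apply/andP; split.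
  apply: gdist_min; move def_n: (\sum_i _) => n; elim: n x def_n => [|n IHn] x.
    move/eqP; rewrite sum_nat_eq0 => /forallP d0; apply/eqP/ffunP => i.
    by apply/eqP; rewrite -(gdist_eq0 (@cGi i)); apply: d0.
  move=> def_n; have [i nxy]: exists i, x i != y i.
    apply/existsP; apply: contraPT def_n; rewrite negb_exists => /forallP exy.
    rewrite big1 // => i _; apply/eqP; rewrite gdist_eq0.
    by have := exy i; rewrite negbK.
  have [u xu du] := gdist_step (@cGi i) nxy.
  apply/existsP; exists (upd x u); apply/andP; split.
    by rewrite (@sadj_coproj i) ?coproj_upd ?upd_in.
  apply/IHn/succn_inj; rewrite -def_n (bigD1 i) //= [RHS](bigD1 i) //= upd_in du addSn.
  by congr (_ + _).+1; apply: eq_bigr => j ji; rewrite upd_out.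
have := walk_gdist cG x y; move: (gdist _ _ _) => n.
elim: n x => [|n IHn] x /=.
  by move/eqP->; rewrite big1 // => i _; rewrite gdistxx.
case/existsP=> z /andP[xz /IHn]; rewrite -ltnS; apply: leq_trans.
have [i xzi exz] := bigbox_sadjP _ _ xz; have /eqP/coprojP ez := exz.
rewrite (bigD1 i) //= [X in _ <= X.+1](bigD1 i) //= -addSn leq_add ?gdist_adj //.
by apply: leq_sum => j /ez->.
Qed.

(** A sum of triangle inequalities is an equality iff each of them is. *)
Lemma between_bigbox z x y :
  between cG z x y = [forall i, between (@cGi i) (z i) (x i) (y i)].
Proof.
rewrite /between !gdist_bigbox -big_split /= eq_sym.
have := @leqif_sum _ (mem I) (fun i => between (@cGi i) (z i) (x i) (y i)).
move=> /(_ (fun i => gdist (@cGi i) (x i) (y i)))/(_ _ _) -> //.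
by move=> i _; split; [apply: gdist_triangle | apply: eq_sym].
Qed.

Lemma between_upd i x y : between cG (upd y (x i)) x y.
Proof.
rewrite between_bigbox; apply/forallP => j; rewrite /between.
have [->|ji] := eqVneq j i; first by rewrite upd_in gdistxx.
by rewrite upd_out // gdistxx addn0.
Qed.

(** Convexity of layers: in a coordinate where x and y agree, z is at total distance 0 from both. *)
Lemma between_coproj i z x y :
  coproj i x = coproj i y -> between cG z x y -> coproj i z = coproj i x.
Proof.
move=> /eqP/coprojP exy; rewrite between_bigbox => /forallP bz.
apply/eqP/coprojP => j ji; have := bz j; rewrite -exy // /between gdistxx.
by rewrite addn_eq0 !gdist_eq0 => /andP[_ /eqP].
Qed.

End ProductDistance.
End Coordinates.

(** * Isomorphisms of products of primes act factorwise *)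

(* [mix] witnesses that the image of [theta] is a box. *)
Lemma prime_box_image (P : sgraph) (J : finType) (H : J -> sgraph)
    (theta : P -> bigbox H) (mix : J -> P -> P -> P) :
  prime_graph P -> injective theta ->
  (forall u v, sadj (theta u) (theta v) = sadj u v) ->
  (forall j u v, theta (mix j u v) = upd (theta v) (theta u j)) ->
  exists j, forall u v, coproj j (theta u) = coproj j (theta v).
Proof.
move=> [P_gt1 primeP] theta_inj theta_adj theta_mix.
have [a [b [_ _ nab]]] := card_gt1P P_gt1.
have /existsP[j nj] : [exists j, theta a j != theta b j].
  apply: contraNT nab; rewrite negb_exists => /forallP eab.
  by apply/eqP/theta_inj/ffunP => j; apply/eqP; have := eab j; rewrite negbK.
exists j => u v; suff eb w : coproj j (theta w) = coproj j (theta b) by rewrite !eb.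
apply/eqP; apply/negPn/negP => nw.
(* If the image also varied outside coordinate j, P would be the product of its slices A and B
   through b: A varies only in coordinate j, witnessed by a, and B only in the other coordinates,
   witnessed by w. *)
pose A := [set u | coproj j (theta u) == coproj j (theta b)].
pose B := [set u | theta u j == theta b j].
have inA u' : mix j u' b \in A by rewrite inE theta_mix coproj_upd.
have inB u' : mix j b u' \in B by rewrite inE theta_mix upd_in.
pose toA u' : induced A := exist _ (mix j u' b) (inA u').
pose toB u' : induced B := exist _ (mix j b u') (inB u').
case: (primeP (induced B) (induced A)).
- apply/card_gt1P; exists (toB w), (toB b); split=> //.
  apply: contraNneq nw => /(congr1 (fun s => coproj j (theta (val s)))) /=.
  by rewrite !theta_mix !coproj_upd => ->.
- apply/card_gt1P; exists (toA a), (toA b); split=> //.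
  apply: contraNneq nj => /(congr1 (fun s => theta (val s) j)) /=.
  by rewrite !theta_mix !upd_in => ->.
exists (fun u' => (toB u', toA u') : box (induced B) (induced A)); split.
  exists (fun ts : box (induced B) (induced A) => mix j (val ts.2) (val ts.1)).
    move=> u' /=; apply: theta_inj; rewrite !theta_mix upd_in.
    by apply: (@coproj_inj _ _ j); rewrite ?coproj_upd ?upd_in.
  move=> [[t tB] [s sA]] /=; congr pair; apply: val_inj; apply: theta_inj => /=.
    move: tB; rewrite inE => /eqP tB; rewrite !theta_mix.
    by apply: (@coproj_inj _ _ j); rewrite ?coproj_upd ?upd_in.
  move: sA; rewrite inE => /eqP sA; rewrite !theta_mix upd_in.
  by apply: (@coproj_inj _ _ j); rewrite ?coproj_upd ?upd_in.
(* With [theta b] as base point, the two components of [theta x] are the images of [toA x] and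
   [toB x]. *)
move=> x y; rewrite -[RHS]theta_adj (sadj_box j _ _ (theta b)) -!theta_mix !theta_adj.
suff [-> ->] : (coproj j (theta x) == coproj j (theta y)) = (toB x == toB y)
            /\ (theta x j == theta y j) = (toA x == toA y) by [].
rewrite -!val_eqE /= -!(inj_eq theta_inj) !theta_mix.
split; apply/eqP/eqP => exy.
- by apply: (@coproj_inj _ _ j); rewrite ?coproj_upd ?upd_in.
- by move/(congr1 (@coproj _ _ j)): exy; rewrite !coproj_upd.
- by rewrite exy.
by move/(congr1 (fun z : bigbox H => z j)): exy; rewrite !upd_in.
Qed.

Lemma layer_image (I J : finType) (G : I -> sgraph) (H : J -> sgraph)
    (phi : bigbox G -> bigbox H) (a : bigbox G) (i : I) :
  is_iso phi -> connected_graph (bigbox G) -> connected_graph (bigbox H) ->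
  prime_graph (G i) ->
  exists j, forall x, coproj i x = coproj i a -> coproj j (phi x) = coproj j (phi a).
Proof.
move=> iso_phi cG cH primeGi; have cGi l := connected_factor (i := l) a cG.
have cHj l := connected_factor (i := l) (phi a) cH.
have [psi [_ phiK psiK]] := is_iso_inv iso_phi.
pose theta (u : G i) := phi (upd a u).
pose mix j u v : G i := psi (upd (theta v) (theta u j)) i.
have [j ej] : exists j, forall u v, coproj j (theta u) = coproj j (theta v).
  apply: (@prime_box_image _ _ _ theta mix) => // [u v|u v|j u v].
  - by move/(can_inj phiK)/(congr1 (fun x : bigbox G => x i)); rewrite !upd_in.
  - by rewrite (iso_phi.2) (@sadj_coproj _ _ i) ?coproj_upd ?upd_in.
  (* The mixed vertex lies between [theta u] and [theta v], so its preimage lies between two points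
     of the i-layer of a, hence in that layer by convexity. It is therefore in the image of
     [theta]. *)
  have btw := between_upd cH cHj j (theta u) (theta v).
  have := btw; rewrite -[X in between _ X _ _]psiK (between_iso iso_phi cG).
  move/(between_coproj cGi (i := i)); rewrite !coproj_upd => /(_ erefl) ez.
  by rewrite /theta -(eq_upd ez) psiK.
exists j => x ex; have := ej (x i) (a i).
by rewrite /theta -(eq_upd ex) -(eq_upd (erefl (coproj i a))).
Qed.

(** The last clause says that i-layers correspond exactly to j-layers. As an equivalence it passes
    to the inverse, and it makes [phi] act on the cofactors. *)
Definition factor_iso (I J : finType) (G : I -> sgraph) (H : J -> sgraph)
    (phi : bigbox G -> bigbox H) (i : I) (j : J) (psi : G i -> H j) : Prop :=
  [/\ is_iso phi, is_iso psi, forall x, phi x j = psi (x i)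
    & forall x y, (coproj j (phi x) == coproj j (phi y)) = (coproj i x == coproj i y)].

Theorem bigbox_iso_factors (I J : finType) (G : I -> sgraph) (H : J -> sgraph)
    (phi : bigbox G -> bigbox H) (a : bigbox G) (i : I) :
  is_iso phi -> connected_graph (bigbox G) -> connected_graph (bigbox H) ->
  (forall i, prime_graph (G i)) -> (forall j, prime_graph (H j)) ->
  exists j, exists psi : G i -> H j, factor_iso phi psi.
Proof.
move=> iso_phi cG cH primeG primeH.
have [phi' [iso_phi' phiK phiK']] := is_iso_inv iso_phi.
have cGi l := connected_factor (i := l) a cG.
have cHj l := connected_factor (i := l) (phi a) cH.
have nontriv (u : G i) : exists v, v != u.
  have [v [w [_ _ nvw]]] := card_gt1P (primeG i).1.
  by have [<-|] := eqVneq v u; [exists w; rewrite eq_sym | exists v].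
have [j lay_j] := layer_image a iso_phi cG cH (primeG i).
have lay_i y : coproj j y = coproj j (phi a) -> coproj i (phi' y) = coproj i a.
  (* The i'-layer of a receiving the preimage contains the whole i-layer of a, which has a second
     vertex; this forces i' = i. *)
  have [i' lay'] := layer_image (phi a) iso_phi' cH cG (primeH j).
  suff <- : i' = i by move=> /lay' ->; rewrite phiK.
  have [v nv] := nontriv (a i); apply/eqP; apply: contraNT nv => nii'.
  have := lay' (phi (upd a v)); rewrite lay_j ?coproj_upd // => /(_ erefl).
  rewrite !phiK => /eqP/coprojP/(_ i); rewrite upd_in eq_sym => -> //.
pose psi (u : G i) := phi (upd a u) j.
pose psi' (v : H j) := phi' (upd (phi a) v) i.
have phi_upd u : phi (upd a u) = upd (phi a) (psi u).
  by apply: eq_upd; apply: lay_j; rewrite coproj_upd.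
have phi'_upd v : phi' (upd (phi a) v) = upd a (psi' v).
  by apply: eq_upd; apply: lay_i; rewrite coproj_upd.
have psiK : cancel psi psi' by move=> u; rewrite /psi' -phi_upd phiK upd_in.
have psiK' : cancel psi' psi by move=> v; rewrite /psi -phi'_upd phiK' upd_in.
have iso_psi : is_iso psi.
  split=> [|u v]; first by exists psi'.
  have := iso_phi.2 (upd a u) (upd a v); rewrite !phi_upd.
  rewrite (@sadj_coproj _ _ j) ?coproj_upd // !upd_in => ->.
  by rewrite (@sadj_coproj _ _ i) ?coproj_upd // !upd_in.
(* [upd a (x i)] lies between x and every vertex of the i-layer of a, a property
   that isomorphisms preserve and that determines it. *)
have coord x : phi x j = psi (x i).
  suff gate : phi (upd a (x i)) = upd (phi a) (phi x j) by rewrite /psi gate upd_in.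
  apply: (@between_antisym _ cH (phi x)).
    rewrite -[upd (phi a) _]phiK' (between_iso iso_phi cG) phi'_upd.
    by rewrite (@upd_eq _ _ _ _ a (upd a (psi' (phi x j)))) ?coproj_upd // between_upd.
  have /upd_eq-> : coproj j (phi a) = coproj j (phi (upd a (x i))).
    by rewrite lay_j // coproj_upd.
  exact: between_upd.
have lay x y : coproj i x = coproj i y -> coproj j (phi x) = coproj j (phi y).
  (* If j' were not j, coordinate j would be constant on the image of the i-layer of y, whereas by
     [coord] it varies there injectively. *)
  have [j' lay'] := layer_image y iso_phi cG cH (primeG i).
  suff <- : j' = j by apply: lay'.
  have [v nv] := nontriv (y i); apply/eqP; apply: contraNT nv => njj'.
  have := lay' (upd y v) (coproj_upd _ _) => /eqP/coprojP/(_ j).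
  by rewrite eq_sym !coord upd_in => /(_ njj')/(can_inj psiK)->.
exists j, psi; split=> // x y; apply/eqP/eqP => [exy|]; last exact: lay.
(* Conversely, moving x inside its i-layer to the i-th coordinate of y gives a vertex with the same
   image as y, so it is y. *)
have /(congr1 phi') : phi (upd x (y i)) = phi y.
  apply: (@coproj_inj _ _ j); last by rewrite !coord upd_in.
  by rewrite -exy; apply: lay; rewrite coproj_upd.
by rewrite !phiK => <-; rewrite coproj_upd.
Qed.

(** * Equivalence of colored graphs *)

Section ColoredIso.
Variables VC EC : Type.
Implicit Types H K L : cgraph VC EC.

Lemma preserves_inv (G H : sgraph) (f : coloring VC EC G) (g : coloring VC EC H)
    (phi : G -> H) (psi : H -> G) :
  is_iso phi -> cancel psi phi -> preserves f g phi -> preserves g f psi.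
Proof.
move=> [_ adj_phi] psiK [vf ef]; split=> [x|x y xy]; first by rewrite -vf psiK.
by rewrite -ef -?adj_phi !psiK.
Qed.

Lemma cg_equiv_sym H K : cg_equiv H K -> cg_equiv K H.
Proof.
move=> [phi [iso_phi pres_phi]]; have [psi [iso_psi _ psiK]] := is_iso_inv iso_phi.
by exists psi; split=> //; apply: preserves_inv pres_phi.
Qed.

Lemma cg_equiv_trans H K L : cg_equiv H K -> cg_equiv K L -> cg_equiv H L.
Proof.
move=> [phi [[bphi aphi] [vphi ephi]]] [psi [[bpsi apsi] [vpsi epsi]]].
exists (psi \o phi); split; [split=> [|x y] | split=> [x|x y xy]]; rewrite /=.
- exact: bij_comp.
- by rewrite apsi.
- by rewrite vpsi.
by rewrite epsi ?aphi // ephi.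
Qed.

(** Symmetry and transitivity make the two predicates equivalent at every argument; extensionality
    then yields the equality by which reduced colors are compared. *)
Lemma cg_equiv_class H K : cg_equiv H K -> cg_class H = cg_class K.
Proof.
move=> HK; apply: functional_extensionality => L.
apply: propositional_extensionality; split; last exact: cg_equiv_trans.
exact: cg_equiv_trans (cg_equiv_sym HK).
Qed.

End ColoredIso.

(** * Inverses of factorwise isomorphisms and their action on cofactors and edge fibers *)

Section FactorIso.
Variables (I J : finType) (G : I -> sgraph) (H : J -> sgraph).

Lemma factor_iso_inv (phi : bigbox G -> bigbox H) (i : I) (j : J) (psi : G i -> H j) :
  factor_iso phi psi ->
  exists phi' psi', [/\ factor_iso phi' psi', cancel phi phi', cancel phi' phi,
    cancel psi psi' & cancel psi' psi].
Proof.
move=> [iso_phi iso_psi coord lay].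
have [phi' [iso_phi' phiK phiK']] := is_iso_inv iso_phi.
have [psi' [iso_psi' psiK psiK']] := is_iso_inv iso_psi.
exists phi', psi'; split=> //; split=> // [y|x y]; last by rewrite -lay !phiK'.
by rewrite -[y in RHS]phiK' coord psiK.
Qed.

(** By [sadj_of_coproj] it suffices that [phi] commutes with replacing the i-th, respectively j-th,
    coordinate of one vertex by that of another. *)
Lemma factor_iso_coproj_sadj (phi : bigbox G -> bigbox H) i j (psi : G i -> H j) x y :
  factor_iso phi psi ->
  sadj (coproj j (phi x)) (coproj j (phi y)) = sadj (coproj i x) (coproj i y).
Proof.
move=> [[_ adj_phi] _ coord lay]; rewrite !sadj_of_coproj -adj_phi.
suff -> : upd (phi x) (phi y j) = phi (upd x (y i)) by [].
apply: (@coproj_inj _ _ j); last by rewrite upd_in !coord upd_in.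
by apply/eqP; rewrite coproj_upd lay coproj_upd.
Qed.

Lemma imset_edge_fiber (phi : bigbox G -> bigbox H) i j (psi : G i -> H j) e E :
  factor_iso phi psi -> E \in edge_fiber e -> phi @: E \in edge_fiber (psi @: e).
Proof.
move=> [[_ adj_phi] _ coord lay]; rewrite !inE.
case/existsP=> a /existsP[b /and4P[/eqP-> ab eab /eqP->]].
apply/existsP; exists (phi a); apply/existsP; exists (phi b).
by rewrite adj_phi ab lay eab !coord !imsetU1 !imset_set1 !eqxx.
Qed.

End FactorIso.

(** * Transport of reduced-factor colorings *)

Section ReducedColoring.
Variables (I J : finType) (G : I -> sgraph) (H : J -> sgraph).
Variables (C : Type) (f : coloring C C (bigbox G)) (g : coloring C C (bigbox H)).

(** The equivalence is the restriction of [phi]; the inverse [phi'] restricts as well because [psi']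
    undoes [psi]. *)
Lemma layer_equiv (phi : bigbox G -> bigbox H) i j (psi : G i -> H j) u :
  factor_iso phi psi -> preserves f g phi ->
  cg_equiv (layer_cgraph f u) (layer_cgraph g (psi u)).
Proof.
move=> fac [vf ef]; have [phi' [psi' [fac' phiK phiK' psiK psiK']]] := factor_iso_inv fac.
have [[_ adj_phi] _ coord _] := fac; have [_ _ coord' _] := fac'.
have fwd (x : layer_cgraph f u) : phi (val x) \in layer (psi u).
  by have := valP x; rewrite !inE coord => /eqP->.
have bwd (y : layer_cgraph g (psi u)) : phi' (val y) \in layer u.
  by have := valP y; rewrite !inE coord' => /eqP->; rewrite psiK.
pose F x : layer_cgraph g (psi u) := exist _ (phi (val x)) (fwd x).
pose F' y : layer_cgraph f u := exist _ (phi' (val y)) (bwd y).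
exists F; split; [split=> [|x y] | split=> [x|x y xy]]; rewrite /=.
- by exists F' => z; apply: val_inj; rewrite /= ?phiK ?phiK'.
- exact: adj_phi.
- exact: vf.
by rewrite !imsetU1 !imset_set1 /= ef.
Qed.

(** The equivalence is the action of [phi] on edges seen as two-element sets. *)
Lemma fiber_equiv (phi : bigbox G -> bigbox H) i j (psi : G i -> H j) e :
  factor_iso phi psi -> preserves f g phi ->
  cg_equiv (fiber_cgraph f e) (fiber_cgraph g (psi @: e)).
Proof.
move=> fac [vf ef]; have [phi' [psi' [fac' phiK phiK' psiK psiK']]] := factor_iso_inv fac.
have fwd (E : fiber_cgraph f e) : phi @: val E \in edge_fiber (psi @: e).
  exact: imset_edge_fiber fac (valP E).
have bwd (E : fiber_cgraph g (psi @: e)) : phi' @: val E \in edge_fiber e.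
  have := imset_edge_fiber fac' (valP E).
  by rewrite -imset_comp (eq_imset _ psiK) imset_id.
pose F (E : fiber_cgraph f e) : fiber_cgraph g (psi @: e) := exist _ (phi @: val E) (fwd E).
pose F' (E : fiber_cgraph g (psi @: e)) : fiber_cgraph f e := exist _ (phi' @: val E) (bwd E).
exists F; split; [split=> [|D E] | split=> [E|//]]; rewrite /=.
- by exists F' => E; apply: val_inj; rewrite /= -imset_comp
    ?(eq_imset _ phiK) ?(eq_imset _ phiK') imset_id.
- apply/existsP/existsP => -[a /andP[/= aD /existsP[b /andP[/= bE ab]]]].
    have [x xD def_a] := imsetP aD; have [y yE def_b] := imsetP bE.
    exists x; rewrite xD; apply/existsP; exists y; rewrite yE.
    by move: ab; rewrite def_a def_b; apply: etrans; exact: esym (factor_iso_coproj_sadj _ _ fac).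
  exists (phi a); rewrite imset_f //; apply/existsP; exists (phi b).
  by rewrite imset_f //; apply: etrans ab; exact: factor_iso_coproj_sadj fac.
(* A vertex of the fiber is a genuine edge of the product, so [ef] governs its color. *)
have := valP E; rewrite inE => /existsP[a /existsP[b /and4P[/eqP-> ab _ _]]].
by rewrite !imsetU1 !imset_set1 ef.
Qed.

Lemma reduced_coloring_preserves (phi : bigbox G -> bigbox H) i j (psi : G i -> H j) :
  factor_iso phi psi -> preserves f g phi ->
  preserves (reduced_coloring f i) (reduced_coloring g j) psi.
Proof.
move=> fac pres; split=> [u|u v _] /=; apply/esym/cg_equiv_class.
  exact: layer_equiv fac pres.
by have := fiber_equiv [set u; v] fac pres; rewrite imsetU1 imset_set1.
Qed.

End ReducedColoring.

(** * Color-preserving automorphisms fix every coordinate *)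

Theorem lemma4p1 (k : nat) (G : 'I_k -> sgraph) (C : Type)
    (f : coloring C C (bigbox G)) (hk : 2 <= k)
    (hconn : connected_graph (bigbox G))
    (hprime : forall i : 'I_k, prime_graph (G i))
    (hdist : forall i : 'I_k, distinguishing (reduced_coloring f i))
    (hniso : forall i j : 'I_k, j != i ->
       ~ cg_equiv (reduced_factor f i) (reduced_factor f j)) :
  distinguishing f.
Proof.
move=> phi iso_phi pres x; apply/ffunP => i.
(* The vertex x itself serves as base point. *)
have [j [psi fac]] := bigbox_iso_factors x i iso_phi hconn hconn hprime hprime.
have pres_psi := reduced_coloring_preserves fac pres.
have [_ iso_psi coord _] := fac.
(* For j other than i, [psi] would be an equivalence between two distinct reduced factors. *)
have [eji|/hniso[]] := eqVneq j i; last by exists psi.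
by subst j; rewrite coord (hdist i psi).
Qed.
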